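(* Fix a positive odd integer $p$ and let $\rho\in\mathbb{C}$ be a root of the equation $r^{p+1}-r^p-r-1=0$ different from $i$ and $-i$. Set $a=\rho-1/\rho$. Let $(x_n)_{n\ge 0}$ be a sequence of complex numbers satisfying $x_{n+2}=ax_{n+1}+x_n$ for every integer $n\ge 0$, and let $(u_n)$ and $(v_n)$ be the sequences satisfying the same recurrence with $u_0=0$, $u_1=1$, and $v_0=2$, $v_1=a$ respectively, where $(u_n)$ is extended to all $n\in\mathbb{Z}$ by the recurrence $u_{n+2}=au_{n+1}+u_n$. For every integer $n\ge 1$ let $S_n=\sum_{k=0}^{n-1}x_k$. Then for every positive even integer $n$ such that $n+p-1$ is a multiple of $4$, $$S_n=\bigl(u_{(n-p+1)/2}+u_{(n+p-1)/2}\bigr)\,x_{(n+p-1)/2} =\begin{cases} v_{(p-1)/2}\,u_{n/2}\,x_{(n+p-1)/2} & \text{if } n\equiv 0 \pmod 4,\\ u_{(p-1)/2}\,v_{n/2}\,x_{(n+p-1)/2} & \text{if } n\equiv 2\pmod 4.\end{cases}$$ *)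

From mathcomp Require Import all_boot all_order all_algebra.
From mathcomp Require Import reals complex.
From mathcomp Require Import zify ring.
Import GRing.Theory Num.Theory.
Local Open Scope ring_scope.

(** Write [r] for [rho] and [s = - 1 / r].  The recurrence has
    characteristic roots [r] and [s], which are distinct because [r ^+ 2 != -1].  So [x] is a combination of
    the geometric sequences [r ^+ k] and [s ^+ k], while [u] and [v] have their
    usual Binet forms.

    Put [n = 2 h] and [p = 2 q + 1], so that the two indices of [u] are [h - q]
    and [h + q], both even.  Evenness and [r * s = -1] give
    [(u (h - q) + u (h + q)) * r ^+ (h + q)
       = (r ^+ (2 h) - 1) * (1 + r ^+ (2 q)) / (r - s)],
    and the equation of [r] says exactly that
    [(1 + r ^+ (2 q)) * (r - 1) = r - s].  The right-hand side is therefore the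
    geometric sum of ratio [r]: this is the first identity for
    [x k = r ^+ k] ([geometric_sum_lucas]).  The equation is invariant under
    [r |-> - 1 / r] for odd [p] ([root_conj]), so the identity also holds for
    [x k = s ^+ k], with the same coefficient, and linearity in [x] gives
    the general case ([sum_lucas]).

    The two factorizations are the product formulas for [v q * u h] and
    [u q * v h] ([mul_lucas_vu], [mul_lucas_uv]), where the parity of [q] decides
    the sign of [u (h - q)]. *)

(** * Sequences with characteristic roots of product -1 *)

Section LucasSequences.
Variables (F : fieldType) (r s : F).
Hypotheses (rs : r * s = -1) (r_neq_s : r != s).

Let r_neq0 : r != 0.
Proof.
by apply: contra_eq_neq rs => ->; rewrite mul0r eq_sym oppr_eq0 oner_neq0.
Qed.

Let rBs_neq0 : r - s != 0. Proof. by rewrite subr_eq0. Qed.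

Lemma linear_rec2_binet (x : nat -> F) :
    (forall n, x n.+2 = (r + s) * x n.+1 + x n) ->
  forall n, (r - s) * x n
    = (x 1 - s * x 0) * r ^+ n - (x 1 - r * x 0) * s ^+ n.
Proof.
move=> x_rec n.
suff: (r - s) * x n
      = (x 1 - s * x 0) * r ^+ n - (x 1 - r * x 0) * s ^+ n
  /\ (r - s) * x n.+1
      = (x 1 - s * x 0) * r ^+ n.+1 - (x 1 - r * x 0) * s ^+ n.+1 by case.
elim: n => [|n [IH0 IH1]]; first by split; ring.
split=> //; rewrite x_rec mulrDr mulrCA IH0 IH1 !exprS.
(* [1 = - r * s] makes both sides homogeneous in [r] and [s] *)
have -> : (x 1 - s * x 0) * r ^+ n - (x 1 - r * x 0) * s ^+ n
  = - (r * s) * ((x 1 - s * x 0) * r ^+ n - (x 1 - r * x 0) * s ^+ n).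
  by rewrite rs opprK mul1r.
by ring.
Qed.

(** Since [s^-1 = - r], the negative powers in the Binet form at [h - q] turn
    into powers of [- s] and [- r] with natural exponents; the recurrence can
    then be run in both directions without any division. *)
Lemma lucas_u_binet (u : int -> F) :
    u 0 = 0 -> u 1 = 1 ->
    (forall n : int, u (n + 2) = (r + s) * u (n + 1) + u n) ->
  forall h q : nat,
    (r - s) * u (h%:Z - q%:Z) = r ^+ h * (- s) ^+ q - s ^+ h * (- r) ^+ q.
Proof.
move=> u0 u1 u_rec.
have u_pos n : (r - s) * u n%:Z = r ^+ n - s ^+ n.
  rewrite (linear_rec2_binet (fun n => u n%:Z)) ?u0 ?u1; first by ring.
  move=> k /=; have -> : k.+2%:Z = k%:Z + 2 by lia.
  by rewrite u_rec; have -> : k.+1%:Z = k%:Z + 1 by lia.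
move=> h q; suff: (r - s) * u (h%:Z - q%:Z)
      = r ^+ h * (- s) ^+ q - s ^+ h * (- r) ^+ q
  /\ (r - s) * u (h%:Z - q%:Z + 1)
      = r ^+ h.+1 * (- s) ^+ q - s ^+ h.+1 * (- r) ^+ q by case.
elim: q => [|q [IH0 IH1]].
  by rewrite subr0 !expr0 !mulr1 -PoszD addn1.
have -> : h%:Z - q.+1%:Z + 1 = h%:Z - q%:Z by lia.
have step := u_rec (h%:Z - q.+1%:Z).
have E1 : h%:Z - q.+1%:Z + 1 = h%:Z - q%:Z by lia.
have E2 : h%:Z - q.+1%:Z + 2 = h%:Z - q%:Z + 1 by lia.
rewrite E1 E2 in step.
have -> : u (h%:Z - q.+1%:Z) = u (h%:Z - q%:Z + 1) - (r + s) * u (h%:Z - q%:Z).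
  by rewrite step; ring.
split; first by rewrite mulrBr mulrCA IH0 IH1 !exprS; ring.
rewrite IH0 !exprS.
have -> : r * r ^+ h * (- s * (- s) ^+ q) - s * s ^+ h * (- r * (- r) ^+ q)
  = - (r * s) * (r ^+ h * (- s) ^+ q - s ^+ h * (- r) ^+ q) by ring.
by rewrite rs opprK mul1r.
Qed.

Lemma lucas_v_binet (v : nat -> F) :
    v 0 = 2 -> v 1 = r + s ->
    (forall n, v n.+2 = (r + s) * v n.+1 + v n) ->
  forall n, v n = r ^+ n + s ^+ n.
Proof.
move=> v0 v1 v_rec n; apply: (mulfI rBs_neq0).
by rewrite linear_rec2_binet // v0 v1; ring.
Qed.

(** * Product formulas *)

Section Products.
Variables (u : int -> F) (v : nat -> F).
Hypotheses (u0 : u 0 = 0) (u1 : u 1 = 1)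
  (u_rec : forall n : int, u (n + 2) = (r + s) * u (n + 1) + u n)
  (v0 : v 0 = 2) (v1 : v 1 = r + s)
  (v_rec : forall n, v n.+2 = (r + s) * v n.+1 + v n).

Let u_sub := lucas_u_binet u u0 u1 u_rec.

Let u_nat n : (r - s) * u n%:Z = r ^+ n - s ^+ n.
Proof. by have := u_sub n 0; rewrite subr0 !expr0 !mulr1. Qed.

Let vE := lucas_v_binet v v0 v1 v_rec.

Lemma mul_lucas_vu h q :
  v q * u h%:Z = u (h + q)%N%:Z + (-1) ^+ q * u (h%:Z - q%:Z).
Proof.
apply: (mulfI rBs_neq0); rewrite mulrDr mulrCA (u_nat h) [in RHS]mulrCA.
rewrite (u_sub h q) (u_nat (h + q)%N) vE !exprD (exprNn r) (exprNn s).
(* [e * e = 1]: the sign of [u (h - q)] cancels the one in its Binet form *)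
have := sqrr_sign F q; move: ((-1) ^+ q) => e; rewrite expr2 => ee.
transitivity (e * e * (r ^+ h * s ^+ q - s ^+ h * r ^+ q)
              + (r ^+ h * r ^+ q - s ^+ h * s ^+ q)); last by ring.
by rewrite ee; ring.
Qed.

Lemma mul_lucas_uv h q :
  u q%:Z * v h = u (h + q)%N%:Z - (-1) ^+ q * u (h%:Z - q%:Z).
Proof.
apply: (mulfI rBs_neq0); rewrite mulrBr mulrA (u_nat q) [in RHS]mulrCA.
rewrite (u_sub h q) (u_nat (h + q)%N) vE !exprD (exprNn r) (exprNn s).
(* [e * e = 1]: the sign of [u (h - q)] cancels the one in its Binet form *)
have := sqrr_sign F q; move: ((-1) ^+ q) => e; rewrite expr2 => ee.
transitivity ((r ^+ h * r ^+ q - s ^+ h * s ^+ q)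
              - e * e * (r ^+ h * s ^+ q - s ^+ h * r ^+ q)); last by ring.
by rewrite ee; ring.
Qed.

(** * Geometric sums *)

(** Since [h + q] is even, [s ^ (h - q)] and [s ^ (h + q)] are the inverses of
    [r ^ (h - q)] and [r ^ (h + q)].  The Binet forms thus turn [r - s] times the
    right-hand side into [(r ^+ (2 h) - 1) * (1 + r ^+ (2 q))], and the equation
    of [r] replaces the second factor by [(r - s) / (r - 1)]. *)
Lemma geometric_sum_lucas h q :
    ~~ odd (h + q) ->
    r ^+ q.*2.+1 * (r - 1) = r + 1 ->
  \sum_(0 <= k < h.*2) r ^+ k
    = (u (h%:Z - q%:Z) + u (h + q)%N%:Z) * r ^+ (h + q).
Proof.
move=> even_hq r_root.
have even_sign : (-1) ^+ h * (-1) ^+ q = 1 :> F.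
  by rewrite -exprD -signr_odd (negbTE even_hq).
have rB1_root : (r - 1) * (1 + r ^+ q * r ^+ q) = r - s.
  apply: (mulfI r_neq0); rewrite mulrBr rs.
  have -> : r * ((r - 1) * (1 + r ^+ q * r ^+ q))
      = r * (r - 1) + r ^+ q.*2.+1 * (r - 1).
    by rewrite exprS -addnn exprD; ring.
  by rewrite r_root; ring.
have rB1_neq0 : r - 1 != 0.
  by apply: contra_neq rBs_neq0 => r1; rewrite -rB1_root r1 mul0r.
apply: (mulfI rB1_neq0); apply: (mulfI rBs_neq0).
rewrite big_mkord -subrX1.
transitivity ((r - 1) * (((r - s) * u (h%:Z - q%:Z)
    + (r - s) * u (h + q)%N%:Z) * r ^+ (h + q))); last by ring.
rewrite (u_sub h q) (u_nat (h + q)%N) -[in LHS]rB1_root.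
rewrite -addnn !exprD (exprNn r) (exprNn s).
(* isolate [s ^+ h * r ^+ h] and [s ^+ q * r ^+ q], which are signs *)
have sr k : s ^+ k * r ^+ k = (-1) ^+ k by rewrite -exprMn mulrC rs.
set A := r ^+ h; set B := r ^+ q; set C := s ^+ h; set D := s ^+ q.
have CA : C * A = (-1) ^+ h := sr h.
have DB : D * B = (-1) ^+ q := sr q.
transitivity ((r - 1) * (A * A * ((-1) ^+ q * (D * B))
   - ((-1) ^+ q * (C * A)) * (B * B)
   + A * A * (B * B) - (C * A) * (D * B))); last by ring.
rewrite CA DB even_sign [(-1) ^+ q * (-1) ^+ h]mulrC even_sign.
by rewrite -(expr2 ((-1) ^+ q)) sqrr_sign; ring.
Qed.

End Products.

(** For odd [p] the equation [z ^+ p * (z - 1) = z + 1] is invariant under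
    [z |-> - 1 / z]: both sides of [z ^+ p = (z + 1) / (z - 1)] are then sent
    to the opposite of their inverse. *)
Lemma root_conj p : odd p ->
  r ^+ p * (r - 1) = r + 1 -> s ^+ p * (s - 1) = s + 1.
Proof.
move=> p_odd r_root.
have rsp : s ^+ p * r ^+ p = -1 by rewrite -exprMn mulrC rs -signr_odd p_odd.
have s_shift : s + 1 = s * (1 - r).
  by rewrite mulrBr (mulrC s r) rs; ring.
have s_pred : s - 1 = s * (1 + r).
  by rewrite mulrDr mulr1 (mulrC s r) rs.
rewrite s_shift s_pred.
have -> : s ^+ p * (s * (1 + r)) = s * (s ^+ p * (r + 1)) by ring.
by rewrite -r_root (mulrA (s ^+ p)) rsp; ring.
Qed.

End LucasSequences.

Lemma sum_lucas (F : fieldType) (r s : F) (u : int -> F) (x : nat -> F) :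
    r * s = -1 -> r != s -> u 0 = 0 -> u 1 = 1 ->
    (forall n : int, u (n + 2) = (r + s) * u (n + 1) + u n) ->
    (forall n, x n.+2 = (r + s) * x n.+1 + x n) ->
  forall h q, ~~ odd (h + q) ->
    r ^+ q.*2.+1 * (r - 1) = r + 1 ->
  \sum_(0 <= k < h.*2) x k
    = (u (h%:Z - q%:Z) + u (h + q)%N%:Z) * x (h + q)%N.
Proof.
move=> rs rs_neq u0 u1 u_rec x_rec h q even_hq r_root.
have rBs_neq0 : r - s != 0 by rewrite subr_eq0.
have xE := linear_rec2_binet _ _ _ rs x x_rec.
have sum_r :=
  geometric_sum_lucas _ _ _ rs rs_neq _ u0 u1 u_rec _ _ even_hq r_root.
have sum_s : \sum_(0 <= k < h.*2) s ^+ k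
    = (u (h%:Z - q%:Z) + u (h + q)%N%:Z) * s ^+ (h + q).
  apply: (geometric_sum_lucas _ s r) => //; first by rewrite mulrC.
  - by rewrite eq_sym.
  - by move=> k; rewrite u_rec (addrC r).
  - by apply: (root_conj _ _ _ rs) r_root; rewrite /= odd_double.
apply: (mulfI rBs_neq0); rewrite big_distrr /=.
under eq_bigr do rewrite xE.
rewrite sumrB -!big_distrr /= sum_r sum_s [RHS]mulrCA xE.
by ring.
Qed.

Theorem theorem5 (R : realType) (p : nat) (rho a : R[i])
    (x v : nat -> R[i]) (u : int -> R[i])
    (p_gt0 : (0 < p)%N) (p_odd : odd p)
    (rho_root : rho ^+ p.+1 - rho ^+ p - rho - 1 = 0)
    (rho_neq_i : rho <> 'i%C) (rho_neq_Ni : rho <> - 'i%C)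
    (aE : a = rho - 1 / rho)
    (x_rec : forall n : nat, x n.+2 = a * x n.+1 + x n)
    (u0 : u 0 = 0) (u1 : u 1 = 1)
    (u_rec : forall n : int, u (n + 2) = a * u (n + 1) + u n)
    (v0 : v 0%N = 2) (v1 : v 1%N = a)
    (v_rec : forall n : nat, v n.+2 = a * v n.+1 + v n)
    (n : nat) (n_gt0 : (0 < n)%N) (n_even : ~~ odd n)
    (n_mod : (4 %| n + p - 1)%N) :
  let S := \sum_(0 <= k < n) x k in
  let m := ((n + p - 1) %/ 2)%N in
  let l := ((n%:Z - p%:Z + 1) %/ 2)%Z in
  S = (u l + u m%:Z) * x m /\
  (n = 0 %[mod 4] ->
     (u l + u m%:Z) * x m = v ((p - 1) %/ 2)%N * u (n %/ 2)%N%:Z * x m) /\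
  (n = 2 %[mod 4] ->
     (u l + u m%:Z) * x m = u ((p - 1) %/ 2)%N%:Z * v (n %/ 2)%N * x m).
Proof.
move=> S m l; rewrite {}/S.
pose q := ((p - 1) %/ 2)%N; pose h := (n %/ 2)%N.
have pE : p = q.*2.+1 by rewrite /q; lia.
have nE : n = h.*2 by rewrite /h; lia.
have mE : m = (h + q)%N by rewrite /m; lia.
have lE : l = h%:Z - q%:Z by rewrite /l; lia.
have even_hq : ~~ odd (h + q) by lia.
have rho_neq0 : rho != 0.
  apply: contra_eq_neq rho_root => ->.
  rewrite exprS mul0r expr0n (gtn_eqF p_gt0) !subr0 sub0r.
  by rewrite oppr_eq0 oner_neq0.
pose s := - rho^-1.
have rs : rho * s = -1 by rewrite mulrN divff.
have rho_neq_s : rho != s.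
  apply/eqP => rhoE.
  have : rho ^+ 2 == 'i%C ^+ 2 by rewrite sqr_i expr2 [X in _ * X]rhoE rs.
  by rewrite eqf_sqr => /orP[] /eqP.
have asum : a = rho + s by rewrite aE mul1r.
have r_root : rho ^+ q.*2.+1 * (rho - 1) = rho + 1.
  rewrite -pE; apply/eqP; rewrite -subr_eq0 -rho_root exprS.
  by apply/eqP; ring.
rewrite {}asum in x_rec u_rec v1 v_rec.
rewrite -/q -/h mE lE; split; last split.
- by rewrite nE; exact: (sum_lucas _ rho s).
- move=> n0; have even_q : ~~ odd q by lia.
  rewrite (mul_lucas_vu _ _ _ rs rho_neq_s u v u0 u1 u_rec v0 v1 v_rec).
  by rewrite -signr_odd (negbTE even_q) mul1r addrC.
- move=> n2; have odd_q : odd q by lia.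
  rewrite (mul_lucas_uv _ _ _ rs rho_neq_s u v u0 u1 u_rec v0 v1 v_rec).
  by rewrite -signr_odd odd_q mulN1r opprK addrC.
Qed.
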